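(* Let $F$ be a positive integer, let $\mathscr{C}(Frob\leq F)$ be the set of all Coe-semigroups $S$ with $F(S)\leq F$, and let $G(\mathscr{C}(Frob\leq F))$ be the graph with vertex set $\mathscr{C}(Frob\leq F)$ in which a pair $(S,T)$ of vertices is an edge if $T=S\cup\{F(S)-1,F(S)\}$. Then $G(\mathscr{C}(Frob\leq F))$ is a tree with root $\mathbb{N}$. Furthermore, if $S\in\mathscr{C}(Frob\leq F)$, then the set of sons of $S$ in the tree $G(\mathscr{C}(Frob\leq F))$ is equal to: (1) $\{S\setminus\{x\}\mid x\text{ is an odd element of }\mathrm{msg}(S)\text{ with }F(S)<x\leq F\}$, if $\{F(S)+1,F(S)+2\}\nsubseteq\{x\in\mathrm{msg}(S)\mid x\leq F\}$; (2) $\{S\setminus\{x\}\mid x\text{ is an odd element of }\mathrm{msg}(S)\text{ with }F(S)<x\leq F\}\cup\{S\setminus\{F(S)+1,F(S)+2\}\}$, if $\{F(S)+1,F(S)+2\}\subseteq\{x\in\mathrm{msg}(S)\mid x\leq F\}$.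
   Context: $\mathbb{N}=\{0,1,2,\ldots\}$. A numerical semigroup is a subset of $\mathbb{N}$ containing $0$, closed under addition and with finite complement in $\mathbb{N}$. A numerical semigroup $S$ is a Coe-semigroup if $\{x-1,x+1\}\subseteq S$ for every odd $x\in S$. The Frobenius number of $S$ is $F(S)=\max(\mathbb{Z}\setminus S)$ (so $F(\mathbb{N})=-1$); the bare letter $F$ denotes a fixed positive integer. $\mathrm{msg}(S)$ is the (unique, finite) minimal system of generators of $S$ as a submonoid of $(\mathbb{N},+)$. A graph is a pair $(V,E)$ with $V$ a nonempty set and $E\subseteq\{(u,v)\mid u,v\in V,\ u\neq v\}$ (edges are ordered pairs of distinct vertices). A path of length $n$ connecting $u$ and $v$ is a sequence of $n$ distinct edges $(v_0,v_1),\ldots,(v_{n-1},v_n)$ with $v_0=u$, $v_n=v$. A graph is a tree with root $r$ if for every vertex $v\neq r$ there exists a unique path connecting $v$ and $r$. If $(u,v)$ is an edge of a tree, $u$ is called a son of $v$. *)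

(* Defs.v *)
From mathcomp Require Import all_boot all_order all_algebra.
From mathcomp Require Import boolp classical_sets functions cardinality.

Set Implicit Arguments.
Unset Strict Implicit.
Unset Printing Implicit Defensive.

Import Order.TTheory GRing.Theory Num.Theory.

Local Open Scope ring_scope.
Local Open Scope classical_set_scope.

Definition submonoid (M : set nat) : Prop :=
  M 0%N /\ forall x y, M x -> M y -> M (x + y)%N.

Definition numerical_semigroup (S : set nat) : Prop :=
  submonoid S /\ finite_set (~` S).

(* An odd natural number is positive, so [x.-1] is the genuine [x - 1]. *)
Definition coe_semigroup (S : set nat) : Prop :=
  numerical_semigroup S /\
  forall x : nat, odd x -> S x -> [set x.-1; x.+1] `<=` S.

(* A set of natural numbers viewed as a set of integers; this is needed because
   the Frobenius number of [setT] is [-1]. *)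
Definition intset (S : set nat) : set int := Posz @` S.

Definition greatest (A : set int) (m : int) : Prop :=
  A m /\ forall z, A z -> z <= m.

(* The default value [0] is never used when [S] is a numerical semigroup. *)
Definition frobenius (S : set nat) : int :=
  xget 0 [set m | greatest (~` intset S) m].

Definition generated (A : set nat) : set nat := smallest submonoid A.

Definition minimal_generators (S A : set nat) : Prop :=
  generated A = S /\ forall B, B `<=` A -> generated B = S -> B = A.

(* The minimal system of generators of a submonoid of [nat] exists and is
   unique, so that the default value [set0] and the choice are immaterial. *)
Definition msg (S : set nat) : set nat :=
  xget set0 [set A | minimal_generators S A].

Record digraph (T : Type) := Digraph {
  vertices : set T;
  edges : set (T * T)
}.

Definition is_graph (T : Type) (G : digraph T) : Prop :=
  vertices G !=set0 /\
  edges G `<=` [set e | [/\ vertices G e.1, vertices G e.2 & e.1 <> e.2]].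

(* The path (u, v_1), (v_1, v_2), ..., (v_{n-1}, v_n) is encoded by its first
   vertex [u] and the sequence [p = [:: v_1; ...; v_n]]; its sequence of edges
   is then [pairmap pair u p]. It is the edges that have to be distinct. *)
Definition is_path (T : eqType) (G : digraph T) (u v : T) (p : seq T) : Prop :=
  [/\ forall e, e \in pairmap pair u p -> edges G e,
      uniq (pairmap pair u p) & last u p = v].

Definition is_rooted_tree (T : eqType) (G : digraph T) (r : T) : Prop :=
  [/\ is_graph G, vertices G r &
      forall v, vertices G v -> v <> r -> exists! p, is_path G v r p].

Definition sons (T : Type) (G : digraph T) (v : T) : set T :=
  [set u | edges G (u, v)].

Definition coe_frob_le (F : nat) : set (set nat) :=
  [set S | coe_semigroup S /\ frobenius S <= F%:Z].

Definition coe_graph (F : nat) : digraph (set nat) := {|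
  vertices := coe_frob_le F;
  edges := [set e | [/\ coe_frob_le F e.1, coe_frob_le F e.2 &
    intset e.2 =
      intset e.1 `|` [set frobenius e.1 - 1; frobenius e.1]]]
|}.

(* Main.v *)
(* The Frobenius number F(S) of a Coe-semigroup S <> N is odd, since an odd
   F(S) + 1 in S would force F(S) in S. Adding F(S) - 1 and F(S) to S gives a
   Coe-semigroup with a smaller Frobenius number, so every S <> N has exactly one
   outgoing edge, this edge lowers the Frobenius number, and iterating leads to N.
   If U is a son of S, then f = F(U) is an odd minimal generator of S, and either
   f - 1 is in U and U = S \ {f}, or f - 1 is not in U; in the latter case f - 2 is
   not in S, hence F(S) = f - 2 and f - 1 is a minimal generator too. *)
Require Import Defs.
From mathcomp Require Import all_boot all_order all_algebra.
From mathcomp Require Import boolp classical_sets functions cardinality.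
From mathcomp Require Import zify.

Set Implicit Arguments.
Unset Strict Implicit.
Unset Printing Implicit Defensive.

Import Order.TTheory GRing.Theory Num.Theory.

Local Open Scope ring_scope.
Local Open Scope classical_set_scope.

(** * Rooted trees from a rank function *)

(* The rank makes the source of an edge never reappear further along a path, so
   that the edges of a path are automatically distinct. *)
Lemma ranked_rooted_tree (T : eqType) (G : digraph T) (r : T) (h : T -> nat) :
    vertices G r -> h r = 0%N ->
    (forall u v, edges G (u, v) -> [/\ vertices G u, vertices G v & (h v < h u)%N]) ->
    (forall u v w, edges G (u, v) -> edges G (u, w) -> v = w) ->
    (forall u, vertices G u -> u <> r -> exists v, edges G (u, v)) ->
  is_rooted_tree G r.
Proof.
move=> Gr hr edgeP edge_fun edge_ex.
have path_cons u v p : is_path G u r (v :: p) -> edges G (u, v) /\ is_path G v r p.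
  move=> [/= pE /andP[_ pU] pl]; split; first by apply: pE; rewrite inE eqxx.
  by split=> // e ep; apply: pE; rewrite inE ep orbT.
have path_rank p u : is_path G u r p -> forall e, e \in pairmap pair u p -> (h e.1 <= h u)%N.
  elim: p u => [//|v p IH] u /path_cons[uv vp] e.
  rewrite inE => /predU1P[->//|/(IH v vp) ev].
  by case: (edgeP _ _ uv) => _ _ /ltnW; apply: leq_trans.
(* Rank 0 leaves no room for descent, so a path stops on reaching [r]; hence neither of two paths
   can extend the other. *)
have root_sink v : ~ edges G (r, v) by move=> /edgeP[_ _]; rewrite hr.
have path_ex n u : (h u <= n)%N -> vertices G u -> exists p, is_path G u r p.
  elim: n u => [|n IH] u hu Gu; have [->|/eqP ur] := eqVneq u r; try by exists [::].
    by have [v /edgeP[_ _]] := edge_ex u Gu ur; rewrite ltnNge (leq_trans hu).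
  have [v uv] := edge_ex u Gu ur; have [_ Gv hv] := edgeP _ _ uv.
  have [p vp] := IH v (leq_trans hv hu) Gv; exists (v :: p).
  case: (vp) => pE pU pl; split=> //=; first by move=> e /predU1P[->|/pE].
  rewrite pU andbT; apply/negP => /(path_rank _ _ vp) /=.
  by rewrite leqNgt hv.
have path_uniq p q u : is_path G u r p -> is_path G u r q -> p = q.
  elim: p q u => [|v p IH] [|w q] u //.
  - by case=> _ _ /= -> /path_cons[/root_sink].
  - by move=> /path_cons[uv _] [_ _ /= ur]; move: uv; rewrite ur => /root_sink.
  - move=> /path_cons[uv vp] /path_cons[uw wq].
    have vw := edge_fun _ _ _ uv uw; rewrite -vw in wq *.
    by rewrite (IH q v vp wq).
split=> //; first split; first by exists r.
  move=> [u v] /edgeP[Gu Gv huv]; split=> //= uv.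
  by rewrite uv ltnn in huv.
move=> v Gv _; have [p vp] := path_ex (h v) v (leqnn _) Gv.
by exists p; split=> // q /(path_uniq _ _ _ vp).
Qed.

(** * Atoms and the minimal system of generators *)

(** These are the atoms of the monoid; [msgE] identifies them with [msg S], turning a choice into a
    membership test. *)
Definition irreducibles (S : set nat) : set nat :=
  [set x | [/\ S x, x <> 0%N &
    forall a b, S a -> S b -> (0 < a)%N -> (0 < b)%N -> x <> (a + b)%N]].

Lemma generated_irreducibles (S : set nat) :
  submonoid S -> generated (irreducibles S) = S.
Proof.
move=> [S0 SD]; apply/seteqP; split => x.
  by apply; split=> // y [].
move=> Sx M [[M0 MD] irrM]; have [n xn] := ubnP x.
elim: n x xn Sx => // n IH x xn Sx.
have [->//|/eqP x0] := eqVneq x 0%N.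
have [/irrM //|red] := pselect (irreducibles S x).
have [a [b [Sa Sb a0 b0 xab]]] :
    exists a b, [/\ S a, S b, (0 < a)%N, (0 < b)%N & x = (a + b)%N].
  apply: contrapT => nab; apply: red; split=> // a b Sa Sb a0 b0 xab.
  by apply: nab; exists a, b.
by rewrite xab; apply: MD; apply: IH => //; lia.
Qed.

(** A sum of two nonzero elements is never an atom, so discarding atoms cannot break closure under
    addition. *)
Lemma submonoidD (S X : set nat) :
  submonoid S -> X `<=` irreducibles S -> submonoid (S `\` X).
Proof.
move=> [S0 SD] XS; split; first by split=> // /XS[].
move=> a b [Sa Xa] [Sb Xb]; have [->//|a0] := eqVneq a 0%N.
have [->|b0] := eqVneq b 0%N; first by rewrite addn0.
split; first exact: SD.
by move=> /XS[_ _ /(_ a b Sa Sb)]; apply; rewrite ?lt0n.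
Qed.

(** If an atom [x] were missing from [A], then [S] without [x] would be a submonoid containing [A],
    hence all of [S]. *)
Lemma irreducibles_sub_generators (S A : set nat) :
  submonoid S -> generated A = S -> irreducibles S `<=` A.
Proof.
move=> MS gA x irrx; apply: contrapT => nAx; have [Sx _ _] := irrx.
suff : (S `\ x) x by case=> _; apply.
rewrite -gA in Sx; apply: Sx; split.
  by apply: submonoidD => // y ->.
move=> y Ay; split; last by move=> yx; apply: nAx; rewrite -yx.
by rewrite -gA => M [_]; apply.
Qed.

Lemma msgE (S : set nat) : submonoid S -> msg S = irreducibles S.
Proof.
move=> MS; apply: xget_unique.
  split; first exact: generated_irreducibles.
  by move=> B BS gB; apply/seteqP; split=> //; apply: irreducibles_sub_generators.
move=> A [gA minA]; apply/esym/minA; last exact: generated_irreducibles.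
exact: irreducibles_sub_generators.
Qed.

(** * The Frobenius number as a largest gap *)

(** This keeps the Frobenius number inside [nat]. Only [setT], whose Frobenius number is [-1], has
    to be treated apart. *)
Definition largest_gap (S : set nat) (m : nat) : Prop :=
  ~ S m /\ forall k, (m < k)%N -> S k.

Lemma intsetE (S : set nat) (n : nat) : intset S n%:Z = S n.
Proof. by apply/propext; split=> [[k Sk [<-]]//|Sn]; exists n. Qed.

Lemma intset_Negz (S : set nat) (n : nat) : ~ intset S (Negz n).
Proof. by case. Qed.

Lemma frobenius_greatest (S : set nat) (z : int) :
  greatest (~` intset S) z -> frobenius S = z.
Proof.
move=> gz; apply: xget_unique => // y [Sy maxy].
by case: gz => Sz maxz; apply/le_anti; rewrite maxz// maxy.
Qed.

Lemma frobenius_setT : frobenius [set: nat] = -1.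
Proof.
apply: frobenius_greatest; split; first exact: intset_Negz.
by case=> n; [rewrite /setC/= intsetE => -[] | move=> _; rewrite NegzE; lia].
Qed.

Lemma frobenius_largest_gap (S : set nat) (m : nat) :
  largest_gap S m -> frobenius S = m%:Z.
Proof.
move=> [Sm Sgt]; apply: frobenius_greatest; split; first by rewrite /setC/= intsetE.
case=> n; last by move=> _; rewrite NegzE; lia.
rewrite /setC/= intsetE => Sn; rewrite lez_nat leqNgt.
by apply/negP => /Sgt.
Qed.

Lemma largest_gap_exists (S : set nat) :
  finite_set (~` S) -> S = setT \/ exists m, largest_gap S m.
Proof.
move=> /finite_seqP[s Ss].
have Sns k : S k <-> k \notin s.
  split=> [Sk|/negP ks]; first by apply/negP => ks; have : (~` S) k by rewrite Ss.
  by apply: contrapT => nSk; apply: ks; have : (~` S) k by []; rewrite Ss.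
case: (pselect (exists k, k \in s)) => [sk|ns]; last first.
  by left; apply/seteqP; split=> // k _; apply/Sns/negP => ks; apply: ns; exists k.
have bnd k : k \in s -> (k <= \max_(i <- s) i)%N by move=> ks; apply: leq_bigmax_seq.
right; have [m ms maxm] := ex_maxnP sk bnd; exists m; split; first by rewrite Sns ms.
by move=> k mk; apply/Sns/negP => /maxm; rewrite leqNgt mk.
Qed.

Lemma numerical_largest_gap (S : set nat) (m : nat) :
  submonoid S -> largest_gap S m -> numerical_semigroup S.
Proof.
move=> MS [_ Sgt]; split=> //; apply: (sub_finite_set _ (finite_II m.+1)).
by move=> k nSk; rewrite /= ltnS leqNgt; apply/negP => /Sgt.
Qed.

Lemma frobenius_lt_mem (S : set nat) (k : nat) :
  finite_set (~` S) -> frobenius S < k%:Z -> S k.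
Proof.
move=> /largest_gap_exists[->//|[m gm]].
by rewrite (frobenius_largest_gap gm) ltz_nat; case: gm => _; apply.
Qed.

Lemma frobenius_lt (S : set nat) (m : nat) :
  finite_set (~` S) -> (forall k, (m <= k)%N -> S k) -> frobenius S < m%:Z.
Proof.
move=> /largest_gap_exists[->|[f gf]] Sge; first by rewrite frobenius_setT.
rewrite (frobenius_largest_gap gf) ltz_nat ltnNge; apply/negP => /Sge.
by case: gf.
Qed.

(** * Filling the gap of a Coe-semigroup, and the edges of the graph *)

Lemma submonoid1 (S : set nat) : submonoid S -> S 1%N -> S = setT.
Proof.
move=> [S0 SD] S1; apply/seteqP; split=> // n _.
by elim: n => // n Sn; rewrite -addn1; apply: SD.
Qed.

Lemma coe_gap_odd (S : set nat) (m : nat) :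
  coe_semigroup S -> largest_gap S m -> odd m.
Proof.
move=> [_ CS] [nSm Sgt]; apply: contrapT => /negP em; apply: nSm.
by apply: (CS m.+1); [rewrite /= em | apply: Sgt | left].
Qed.

Lemma gap_no_1 (S : set nat) (m : nat) :
  submonoid S -> largest_gap S m -> ~ S 1%N.
Proof. by move=> MS [nSm _] /(submonoid1 MS) ST; rewrite ST in nSm; apply: nSm. Qed.

Lemma coe_fill (S : set nat) (m : nat) : coe_semigroup S -> largest_gap S m ->
  coe_semigroup (S `|` [set m.-1; m]).
Proof.
move=> CS gm; have om := coe_gap_odd CS gm.
have n1 := gap_no_1 CS.1.1 gm.
case: CS gm => [[[S0 SD] finS] CS] [nSm Sgt].
(* For [a] at least 2 the sum exceeds [m]. The case [a = 1] forces [m = 1], since [1] is not in [S]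
   and [m.-1 = 1] contradicts the parity of [m]. *)
have big a b : (S `|` [set m.-1; m]) a -> (m.-1 <= b)%N ->
    (S `|` [set m.-1; m]) b -> (S `|` [set m.-1; m]) (a + b)%N.
  move=> Ta mb Tb; have [->//|a0] := eqVneq a 0%N.
  have [a1|a1] := eqVneq a 1%N.
    rewrite a1 in Ta *; case: Ta => [//|] [] /= e1.
      have e : m = 2%N by lia.
      by rewrite e in om.
    have [->|b0] := eqVneq b 0%N; first by right; right; rewrite addn0.
    by left; apply: Sgt; lia.
  by left; apply: Sgt; lia.
split; first split.
- split; first by left.
  move=> a b Ta Tb; have [mb|bm] := leqP m.-1 b; first exact: big.
  have [ma|am] := leqP m.-1 a; first by rewrite addnC; apply: big.
  case: Ta => [Sa|[] /= ?]; [|lia|lia].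
  case: Tb => [Sb|[] /= ?]; [|lia|lia].
  by left; apply: SD.
- by apply: sub_finite_set finS => k /= nT Sk; apply: nT; left.
move=> x ox [Sx|[] /= ex]; last 1 first.
- by rewrite ex => y [] ->; [right; left | left; apply: Sgt].
- by move=> y /(CS x ox Sx); left.
by move: ox om; rewrite ex; case: (m) => //= n ->.
Qed.

Lemma frobenius_fill (S : set nat) (m : nat) : coe_semigroup S -> largest_gap S m ->
  frobenius (S `|` [set m.-1; m]) < m%:Z.
Proof.
move=> CS gm; apply: frobenius_lt; first exact: (coe_fill CS gm).1.2.
move=> k; rewrite leq_eqVlt => /predU1P[->|/gm.2]; first by right; right.
by left.
Qed.

(** This moves the edge relation from integers to naturals: [m] is odd, hence positive, so [m.-1] is
    a true predecessor. That the target is a vertex follows from [coe_fill] and [frobenius_fill]. *)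
Lemma coe_edgeP (F : nat) (U S : set nat) : edges (coe_graph F) (U, S) <->
  exists m : nat, [/\ coe_semigroup U, largest_gap U m, (m <= F)%N
                    & S = U `|` [set m.-1; m]].
Proof.
split.
  move=> [/= [CU UF] _ E].
  have [UT|[m gm]] := largest_gap_exists CU.1.2.
    (* [Negz 0] is [-1], the Frobenius number of [setT]; an edge leaving [setT] would put it into a
       set of naturals. *)
    have : intset S (Negz 0) by rewrite E UT frobenius_setT; right; right.
    by move/intset_Negz.
  exists m; rewrite (frobenius_largest_gap gm) in UF E; split=> //.
  have m0 := odd_gt0 (coe_gap_odd CU gm).
  have predm : m%:Z - 1 = m.-1%:Z by lia.
  rewrite predm in E.
  apply/seteqP; split=> k.
    rewrite -intsetE E => -[|[] [->]]; first by rewrite intsetE; left.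
      by right; left.
    by right; right.
  by rewrite -[S k]intsetE E; case=> [|[] ->];
    [rewrite -intsetE; left|right; left|right; right].
move=> [m [CU gm mF ->]]; have m0 := odd_gt0 (coe_gap_odd CU gm).
have CT := coe_fill CU gm; have fU := frobenius_largest_gap gm.
split=> /=.
- by split=> //; rewrite fU lez_nat.
- split=> //; apply/ltW/(lt_le_trans (frobenius_fill CU gm)).
  by rewrite lez_nat.
- have predm : m%:Z - 1 = m.-1%:Z by lia.
  rewrite fU predm; apply/seteqP; split=> [z [k Tk <-]|[k|k]].
  + case: Tk => [Uk|[] ->]; [left; exists k => // | right; left=> // | right; right=> //].
  + by rewrite intsetE => -[|[] [->]]; [rewrite intsetE; left|right; left|right; right].
  + by case=> [/intset_Negz|[]].
Qed.

(** * The tree *)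

Lemma coe_frob_le_setT (F : nat) : coe_frob_le F [set: nat].
Proof.
split; last by rewrite frobenius_setT.
by do 2?split=> //; rewrite setCT; apply: finite_set0.
Qed.

Lemma coe_graph_rooted_tree (F : nat) : is_rooted_tree (coe_graph F) [set: nat].
Proof.
(* The shift by one gives the root rank 0 and makes the absolute value harmless, Frobenius numbers
   being at least [-1]. *)
apply: (@ranked_rooted_tree _ _ _ (fun S => `|(frobenius S + 1)%R|%N)).
- exact: coe_frob_le_setT.
- by rewrite frobenius_setT.
- move=> U S US; have [/= VU VS _] := US; split=> //.
  have /coe_edgeP[m [CU gm _ SE]] := US.
  have := frobenius_fill CU gm; rewrite -SE => lt_m.
  rewrite (frobenius_largest_gap gm).
  have [->|[f gf]] := largest_gap_exists VS.1.1.2; first by rewrite frobenius_setT; lia.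
  by rewrite (frobenius_largest_gap gf) in lt_m *; lia.
- move=> U S S' /coe_edgeP[m [_ gm _ ->]] /coe_edgeP[m' [_ gm' _ ->]].
  have := frobenius_largest_gap gm; rewrite (frobenius_largest_gap gm').
  by move=> [->].
- move=> U [CU UF] UT; have [//|[m gm]] := largest_gap_exists CU.1.2.
  exists (U `|` [set m.-1; m]); apply/coe_edgeP; exists m; split=> //.
  by rewrite (frobenius_largest_gap gm) lez_nat in UF.
Qed.

(** * The sons of a vertex *)

(** A splitting of [m] inside [U] contradicts the gap. Any other one pairs [m.-1] with [1], but [1]
    is not in [U], and [m.-1 = 1] is excluded by parity. *)
Lemma son_generator (U : set nat) (m : nat) :
  coe_semigroup U -> largest_gap U m -> irreducibles (U `|` [set m.-1; m]) m.
Proof.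
move=> CU gm; have om := coe_gap_odd CU gm.
have n1 := gap_no_1 CU.1.1 gm; case: gm => nUm _.
split; [by right; right | lia |] => a b Ta Tb a0 b0 mab.
case: Ta => [Ua|[] /= ea]; last by lia.
  case: Tb => [Ub|[] /= eb]; last by lia.
    by apply: nUm; rewrite mab; apply: CU.1.1.2.
  by apply: n1; have -> : 1%N = a by lia.
have b1 : b = 1%N by lia.
case: Tb => [Ub|[] /= eb]; first by apply: n1; rewrite -b1.
  by lia.
by lia.
Qed.

Lemma son_generator_pred (U : set nat) (m : nat) :
  coe_semigroup U -> largest_gap U m -> ~ U m.-1 ->
  irreducibles (U `|` [set m.-1; m]) m.-1.
Proof.
move=> CU gm nU; split; first by right; left.
  by move=> m0; rewrite m0 in nU; apply: nU CU.1.1.1.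
move=> a b Ta Tb a0 b0 mab; apply: nU; rewrite mab.
case: Ta => [Ua|[] /= ?]; [|lia|lia].
case: Tb => [Ub|[] /= ?]; [|lia|lia].
exact: CU.1.1.2.
Qed.

(** If the odd number [m.-2] were in [U], the Coe property would put [m.-1] there. The case [m = 1]
    is excluded because [0] is in [U]. *)
Lemma largest_gap_fill (U : set nat) (m : nat) :
  coe_semigroup U -> largest_gap U m -> ~ U m.-1 ->
  (1 < m)%N /\ largest_gap (U `|` [set m.-1; m]) m.-2.
Proof.
move=> CU gm nU; have om := coe_gap_odd CU gm.
have m1 : (1 < m)%N.
  rewrite ltnNge; apply/negP => m1; apply: nU.
  by have -> : m.-1 = 0%N by [lia]; exact: CU.1.1.1.
split=> //; split.
  case=> [Um|[] /= ?]; [|lia|lia].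
  by apply: nU; apply: (CU.2 m.-2) => //; [lia | right=> /=; lia].
move=> k mk; have [->|km] := eqVneq k m.-1; first by right; left.
have [->|km'] := eqVneq k m; first by right; right.
by left; apply: gm.2; lia.
Qed.

(** Both kinds of sons come from here, with [X] equal to [[set x]] or to the pair [x.-1], [x].
    Removing the even number [x.-1] can only harm its odd neighbours: [x] is removed as well, and
    the last hypothesis excludes [x.-2]. *)
Lemma coe_remove (S X : set nat) (x : nat) :
    coe_semigroup S -> X `<=` irreducibles S -> X x -> X `<=` [set x.-1; x] ->
    odd x -> frobenius S < x%:Z -> (X x.-1 -> ~ S x.-2) ->
  [/\ coe_semigroup (S `\` X), largest_gap (S `\` X) x
    & S = (S `\` X) `|` [set x.-1; x]].
Proof.
move=> CS XS Xx Xsub ox ltx predx.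
have gx : largest_gap (S `\` X) x.
  split; first by case=> _; apply.
  move=> k xk; split; last by move=> /Xsub[] /= ?; lia.
  by apply: frobenius_lt_mem; [exact: CS.1.2 | rewrite (lt_trans ltx)].
have MSX : submonoid (S `\` X) by apply: submonoidD => //; exact: CS.1.1.
have Sx : S x by case: (XS _ Xx).
split=> //.
  split; first exact: numerical_largest_gap gx.
  move=> y oy [Sy nXy] z yz; split; first exact: CS.2 yz.
  move=> Xz; case: (Xsub _ Xz) => /= zE; last by case: yz => /= ?; lia.
  have y_pred : y = x.-2 \/ y = x.
    case: yz => /= yz; [right; lia | left; lia].
  case: y_pred => yE; rewrite yE in Sy nXy; last exact: nXy.
  by apply: predx => //; rewrite -zE.
apply/seteqP; split=> k.
  move=> Sk; have [Xk|nXk] := pselect (X k); [right; exact: Xsub|by left].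
by case=> [[]//|[] ->//]; apply: (CS.2 x) => //; left.
Qed.

Lemma next_generatorsP (F : nat) (S : set nat) : coe_semigroup S ->
  ([set frobenius S + 1; frobenius S + 2]
     `<=` intset [set x | msg S x /\ (x <= F)%N]) <->
  exists m, [/\ largest_gap S m, irreducibles S m.+1, irreducibles S m.+2
              & (m.+2 <= F)%N].
Proof.
move=> CS; rewrite (msgE CS.1.1).
have next m i : m%:Z + i%:Z = (i + m)%:Z by lia.
split.
  have [->|[m gm]] := largest_gap_exists CS.1.2.
    (* For [setT] the first candidate is [-1 + 1 = 0], which is not an atom. *)
    rewrite frobenius_setT => /(_ 0) [].
      by left.
    by move=> k [[_ k0 _] _] [].
  rewrite (frobenius_largest_gap gm) => gens; exists m.
  have := gens (m.+1)%:Z; rewrite intsetE => -[|irr1 _]; first by left=> /=; lia.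
  have := gens (m.+2)%:Z; rewrite intsetE => -[|irr2 mF]; first by right=> /=; lia.
  by [].
move=> [m [gm irr1 irr2 mF]] z; rewrite (frobenius_largest_gap gm).
by case=> ->; rewrite next intsetE; split=> //; lia.
Qed.

Lemma Posz_preimage_next (m : nat) :
  Posz @^-1` [set m%:Z + 1; m%:Z + 2] = [set m.+1; m.+2].
Proof. by apply/seteqP; split=> k [] /= ?; [left|right|left|right] => /=; lia. Qed.

Lemma son_remove1 (F : nat) (S : set nat) (x : nat) :
    coe_semigroup S -> irreducibles S x -> odd x -> frobenius S < x%:Z ->
    (x <= F)%N ->
  edges (coe_graph F) (S `\ x, S).
Proof.
move=> CS irrx ox ltx xF; apply/coe_edgeP; exists x.
have [||||CU gU SE] := @coe_remove S [set x] x CS _ _ _ ox ltx => //.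
- by move=> y ->.
(* The singleton contains [x.-1] only if [x = 0], which oddness rules out. *)
- by move=> /= xE; have := odd_gt0 ox; lia.
Qed.

Lemma son_remove2 (F : nat) (S : set nat) (m : nat) :
    coe_semigroup S -> largest_gap S m -> irreducibles S m.+1 ->
    irreducibles S m.+2 -> (m.+2 <= F)%N ->
  edges (coe_graph F) (S `\` [set m.+1; m.+2], S).
Proof.
move=> CS gm irr1 irr2 mF; apply/coe_edgeP; exists m.+2.
have om : odd m.+2 by rewrite /= negbK; apply: coe_gap_odd gm.
have lt_m : frobenius S < (m.+2)%:Z by rewrite (frobenius_largest_gap gm) ltz_nat.
have [||||CU gU SE] := @coe_remove S [set m.+1; m.+2] m.+2 CS _ _ _ om lt_m => //.
- by move=> y [] ->.
- by right.
(* With [x = m.+2], the number [x.-2] is the gap [m] itself. *)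
- by case: gm.
Qed.

Lemma son_cases (F : nat) (U S : set nat) :
  coe_semigroup S -> edges (coe_graph F) (U, S) ->
  (exists x, [/\ irreducibles S x, odd x, frobenius S < x%:Z & (x <= F)%N]
     /\ U = S `\ x) \/
  (exists m, [/\ largest_gap S m, irreducibles S m.+1, irreducibles S m.+2
              & (m.+2 <= F)%N] /\ U = S `\` [set m.+1; m.+2]).
Proof.
move=> CS /coe_edgeP[m [CU gm mF SE]].
have lt_m := frobenius_fill CU gm; have irrm := son_generator CU gm.
have om := coe_gap_odd CU gm.
have [Up|nUp] := pselect (U m.-1); [left|right].
  exists m; rewrite SE; split=> //; apply/seteqP; split=> k.
    by move=> Uk; split; [left | move=> km; case: gm; rewrite -km].
  by case=> -[//|[] -> //] nm; case: nm.
have irrp := son_generator_pred CU gm nUp.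
have [m1 gS] := largest_gap_fill CU gm nUp.
(* The witness is the largest gap of [S]; the truncated predecessors are genuine because [1 < m]. *)
exists m.-2; have -> : (m.-2).+2 = m by lia.
have -> : (m.-2).+1 = m.-1 by lia.
rewrite SE; split=> //; apply/seteqP; split=> k.
  by move=> Uk; split; [left | case=> km; [apply: nUp | case: gm]; rewrite -km].
by case=> -[].
Qed.

Theorem theorem23 (F : nat) (F_gt0 : (0 < F)%N) :
  is_rooted_tree (coe_graph F) [set: nat] /\
  forall S : set nat, coe_frob_le F S ->
    (~ ([set frobenius S + 1; frobenius S + 2]
          `<=` intset [set x | msg S x /\ (x <= F)%N]) ->
     sons (coe_graph F) S =
       [set S `\ x | x in
         [set x : nat |
           [/\ msg S x, odd x, frobenius S < x%:Z & (x <= F)%N]]]) /\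
    ([set frobenius S + 1; frobenius S + 2]
       `<=` intset [set x | msg S x /\ (x <= F)%N] ->
     sons (coe_graph F) S =
       [set S `\ x | x in
         [set x : nat |
           [/\ msg S x, odd x, frobenius S < x%:Z & (x <= F)%N]]]
       `|` [set S `\` Posz @^-1` [set frobenius S + 1; frobenius S + 2]]).
Proof.
split; first exact: coe_graph_rooted_tree.
move=> S [CS _]; rewrite (next_generatorsP F CS) (msgE CS.1.1); split.
  move=> nogens; apply/seteqP; split=> U.
    by move=> /(son_cases CS)[[x [xP ->]]|[m [mP _]]]; [exists x | case: nogens; exists m].
  by move=> [x [irrx ox ltx xF] <-]; apply: son_remove1.
move=> [m [gm irr1 irr2 mF]].
(* The Frobenius number becomes [m] just long enough to compute the removed pair in [nat]. *)
rewrite (frobenius_largest_gap gm) Posz_preimage_next -(frobenius_largest_gap gm).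
apply/seteqP; split=> U.
  move=> /(son_cases CS)[[x [xP ->]]|[n [[gn _ _ _] ->]]]; [by left; exists x | right].
  (* Both [n] and [m] represent the Frobenius number of [S], so the removed pairs coincide. *)
  have := frobenius_largest_gap gn; rewrite (frobenius_largest_gap gm).
  by move=> [->].
move=> [[x [irrx ox ltx xF] <-]|->]; first exact: son_remove1.
exact: son_remove2.
Qed.
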